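(* Let $X$ be a Banach space, $q>0$, $f:X\to\mathbb R\cup\{+\infty\}$ lower semicontinuous and convex, and let $\bar x\in\mathrm{dom}\,f$ be a local minimizer of $f$. Consider the following assertions: (i) $\bar x$ is a $(q+1)$-order sharp minimizer of $f$ with modulus $\rho>0$; (ii) $D_q\partial f(\bar x,0)$ is $q$-order positively definite with modulus $\lambda>0$. Then (i) $\Rightarrow$ (ii) with $\lambda:=\rho$. If $\dim X<+\infty$, then, for any $\tau\in(0,\lambda)$, (ii) $\Rightarrow$ (i) with $\rho:=\frac{q^q}{(q+1)^{q+1}}\tau$. As a consequence, if $\dim X<+\infty$, then $\bar x$ is a $(q+1)$-order sharp minimizer of $f$ if and only if $D_q\partial f(\bar x,0)$ is $q$-order positively definite, and $$\frac{q^q}{(q+1)^{q+1}}\|D_q\partial f(\bar x,0)\|^*_q\le\mathrm{shrp}_{q+1}f(\bar x)\le\|D_q\partial f(\bar x,0)\|^*_q .$$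
   Context: $\mathrm{dom}\,f=\{x: f(x)<+\infty\}$; $X^*$ is the topological dual of $X$, $\langle\cdot,\cdot\rangle$ the duality pairing; $\partial f:X\rightrightarrows X^*$ is the subdifferential mapping of convex analysis. Sharp minimizer: for $s>0$, $\bar x\in\mathrm{dom}\,f$ is an $s$-order sharp minimizer of $f$ with modulus $\tau>0$ if there is a neighbourhood $U$ of $\bar x$ with $\tau\|x-\bar x\|^s\le f(x)-f(\bar x)$ for all $x\in U$. The supremum of all such $\tau>0$ is $\mathrm{shrp}_sf(\bar x)\in[0,+\infty]$ (equal to $0$ if there is none). For a set-valued mapping $F:X\rightrightarrows Y$ and $(\bar x,\bar y)\in\mathrm{gph}\,F=\{(x,y):y\in F(x)\}$, the $q$-order graphical derivative $D_qF(\bar x,\bar y):X\rightrightarrows Y$ is defined by: $y\in D_qF(\bar x,\bar y)(x)$ iff there exist $(x_k,y_k)\to(x,y)$ and $t_k\downarrow0$ with $(\bar x+t_kx_k,\bar y+t_k^qy_k)\in\mathrm{gph}\,F$ for all $k\in\mathbb N$. $D_q\partial f(\bar x,0)$ is this derivative for $F=\partial f$, $Y=X^*$. A mapping $H:X\rightrightarrows X^*$ is $q$-order positively definite with modulus $\lambda>0$ if $\langle x^*,x\rangle\ge\lambda\|x\|^{q+1}$ for all $(x,x^* )\in\mathrm{gph}\,H$; it is $q$-order positively definite if this holds for some $\lambda>0$. The supremum of all such $\lambda$ is $\|H\|^*_q\in[0,+\infty]$ (equal to $0$ if there is none); equivalently $\|H\|^*_q=\inf_{(x,x^* )\in\mathrm{gph}\,H,\,x\ne0}\frac{\max\{0,\langle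 x^*,x\rangle\}}{\|x\|^{q+1}}$ with $\inf\emptyset=+\infty$. *)

(* Defs.v *)
From HB Require Import structures.
From mathcomp Require Import all_boot all_order all_algebra.
From mathcomp Require Import all_classical all_reals all_analysis.

Set Implicit Arguments.
Unset Strict Implicit.
Unset Printing Implicit Defensive.

Import Order.TTheory GRing.Theory Num.Theory.
Import numFieldNormedType.Exports.

Local Open Scope classical_set_scope.
Local Open Scope ring_scope.

(** The topological dual [dual X] of a normed space [X]: the continuous linear
    forms, a subspace of [X -> R^o], normed by
    [`|l| = sup {`|l x| : `|x| <= 1}]. *)

Section dual_pred.
Context {R : realType} {X : normedModType R}.

Definition dual_pred : {pred (X -> R^o)} :=
  mem [set l : X -> R^o | linear l /\ continuous l].

Lemma dual_submod_closed : submod_closed dual_pred.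
Proof.
split.
  rewrite inE /=; split; last by move=> x; exact: cvg_cst.
  by move=> a x y /=; rewrite scaler0 addr0.
move=> a u v; rewrite !inE /= => -[ul uc] [vl vc]; split.
  move=> b x y; rewrite !fctE ul vl !scalerDr !scalerA (mulrC a b).
  by rewrite addrACA.
by move=> x; apply: cvgD; [apply: cvgZl_tmp; exact: uc|exact: vc].
Qed.

HB.instance Definition _ :=
  GRing.isSubmodClosed.Build R (X -> R^o) dual_pred dual_submod_closed.

End dual_pred.

Record dual (R : realType) (X : normedModType R) := Dual {
  dual_fun :> X -> R^o ;
  dual_funP : dual_fun \in dual_pred }.

Section dual_lmod.
Context {R : realType} {X : normedModType R}.

HB.instance Definition _ := [isSub of dual X for @dual_fun R X].
HB.instance Definition _ := [Choice of dual X by <:].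
HB.instance Definition _ := [SubChoice_isSubLmodule of dual X by <:].

End dual_lmod.

Section dual_norm.
Context {R : realType} {X : normedModType R}.
Implicit Types l : dual X.

Definition dual_norm l : R := sup [set `|l x| | x in [set x : X | `|x| <= 1]].

Lemma dual_linear l : linear l.
Proof. by have := dual_funP l; rewrite inE => -[]. Qed.

Lemma dual_continuous l : continuous l.
Proof. by have := dual_funP l; rewrite inE => -[]. Qed.

HB.instance Definition _ l :=
  GRing.isLinear.Build R X R^o *:%R (dual_fun l) (@dual_linear l).

Lemma dual_has_sup l : has_sup [set `|l x| | x in [set x : X | `|x| <= 1]].
Proof.
split; first by exists `|l 0|, 0; rewrite //= normr0.
have /bounded_funP/(_ 1)[M lM] :
    bounded_near (dual_fun l) (nbhs (0 : X)).
  by apply/linear_bounded_continuous; exact: dual_continuous.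
by exists M => _ [x /= x1 <-]; exact: lM.
Qed.

Lemma dual_norm_ub l x : `|x| <= 1 -> `|l x| <= dual_norm l.
Proof. by move=> x1; apply: sup_upper_bound; [exact: dual_has_sup|exists x]. Qed.

Lemma dual_norm_le l M :
  (forall x, `|x| <= 1 -> `|l x| <= M) -> dual_norm l <= M.
Proof.
move=> lM; apply: ge_sup; first by have [] := dual_has_sup l.
by move=> _ [x /= x1 <-]; exact: lM.
Qed.

Lemma dual_norm_ge0 l : 0 <= dual_norm l.
Proof.
by apply: le_trans (@dual_norm_ub l 0 _); rewrite ?normr_ge0 ?normr0.
Qed.

Lemma dual_normD l1 l2 : dual_norm (l1 + l2) <= dual_norm l1 + dual_norm l2.
Proof.
apply: dual_norm_le => x x1; apply: le_trans (ler_normD (l1 x) (l2 x)) _.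
by apply: lerD; exact: dual_norm_ub.
Qed.

Lemma dual_normZ (a : R) l : dual_norm (a *: l) = `|a| * dual_norm l.
Proof.
apply/eqP; rewrite eq_le; apply/andP; split.
  apply: dual_norm_le => x x1.
  have -> : (a *: l) x = a *: (l x) by [].
  by rewrite normrZ; apply: ler_wpM2l => //; exact: dual_norm_ub.
have [->|a0] := eqVneq a 0; first by rewrite normr0 mul0r dual_norm_ge0.
rewrite -ler_pdivlMl ?normr_gt0//; apply: dual_norm_le => x x1.
rewrite ler_pdivlMl ?normr_gt0// -normrZ.
exact: (@dual_norm_ub (a *: l) x x1).
Qed.

Lemma dual_norm_eq0 l : dual_norm l = 0 -> l = 0.
Proof.
move=> l0; apply/val_inj/funext => x /=.
have [->|x0] := eqVneq x 0; first by rewrite linear0.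
have : `|l (`|x|^-1 *: x)| <= 0.
  rewrite -l0; apply: dual_norm_ub.
  by rewrite normrZ normfV normr_id mulVf// normr_eq0.
rewrite normr_le0 linearZ scaler_eq0 invr_eq0 normr_eq0 (negbTE x0) /=.
by move/eqP.
Qed.

HB.instance Definition _ := Lmodule_isNormed.Build R (dual X)
  dual_normD dual_normZ dual_norm_eq0.

End dual_norm.

Section sharp_minimizers.
Context {R : realType} {X : normedModType R}.
Implicit Types (f : X -> \bar R) (x : X) (s tau : R).

Definition finite_dimensional (V : normedModType R) :=
  exists (n : nat) (e : 'I_n -> V),
    forall v : V, exists c : 'I_n -> R, v = \sum_(i < n) c i *: e i.

Definition edom f : set X := [set x | (f x < +oo)%E].

(** No [+oo - oo] arises as [f] is assumed never to be [-oo]; at the ends of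
    [0, 1] one has [0 * +oo = 0], so the inequality is trivial there. *)
Definition econvex f := forall (x y : X) (t : R), 0 <= t <= 1 ->
  (f (t *: x + (1 - t) *: y)%R <= t%:E * f x + (1 - t)%:E * f y)%E.

Definition local_minimizer f x := \forall u \near x, (f x <= f u)%E.

Definition sharp_minimizer_mod s f x tau :=
  [/\ 0 < tau, edom f x &
      \forall u \near x, ((tau * `|u - x| `^ s)%:E <= f u - f x)%E].

Definition sharp_minimizer s f x := exists tau, sharp_minimizer_mod s f x tau.

(** The element [0] makes the supremum [0], and not [-oo], when there is no
    modulus. *)
Definition shrp s f x : \bar R :=
  ereal_sup (0%E |` [set tau%:E | tau in sharp_minimizer_mod s f x]).

Definition subdifferential f x : set (dual X) :=
  [set l | edom f x /\ forall u, ((l (u - x))%:E <= f u - f x)%E].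

End sharp_minimizers.

Section graphical_derivative.
Context {R : realType}.

Definition gph (X Y : Type) (F : X -> set Y) : set (X * Y) :=
  [set z | F z.1 z.2].

Definition graphical_derivative (X Y : normedModType R) (q : R)
    (F : X -> set Y) (xbar : X) (ybar : Y) : X -> set Y :=
  fun x => [set y | exists (u : nat -> X) (v : nat -> Y) (t : nat -> R),
    [/\ u @ \oo --> x, v @ \oo --> y,
        (forall k, 0 < t k) /\ t @ \oo --> (0 : R) &
        forall k, gph F (xbar + t k *: u k, ybar + (t k `^ q) *: v k)]].

Context {X : normedModType R}.
Implicit Types (H : X -> set (dual X)) (q lambda : R).

Definition posdef_mod q H lambda := 0 < lambda /\
  forall z : X * dual X, gph H z -> lambda * `|z.1| `^ (q + 1) <= z.2 z.1.

Definition posdef q H := exists lambda, posdef_mod q H lambda.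

(** As for [shrp], the value is [0] when there is no modulus. *)
Definition posdef_norm q H : \bar R :=
  ereal_sup (0%E |` [set lambda%:E | lambda in posdef_mod q H]).

End graphical_derivative.

(* Main.v *)
(** (i) => (ii): if [t ^ q v] is a subgradient of [f] at [xbar + t u], testing
    the subgradient inequality at [xbar] gives [v u >= rho |u| ^ (q + 1)], which
    passes to the limit.

    (ii) => (i): if sharpness with modulus [c tau] fails, there are points
    [z -> xbar] with [f z < f xbar + c tau r ^ (q + 1)], [r = |z - xbar|].
    Minimizing [f + sigma |. - z|] with [sigma = (q + 1) c tau r ^ q] yields [y]
    with [|y - z| < r / (q + 1)] and, by a Hahn-Banach sandwich, a subgradient
    [l] of [f] at [y] with [|l| <= sigma <= tau |y - xbar| ^ q]. Rescaling and
    extracting convergent subsequences produces [(x, v)] in the graph of the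
    graphical derivative with [|x| = 1] and [v x <= tau < lambda]. *)

Require Import Defs.
From HB Require Import structures.
From mathcomp Require Import all_boot all_order all_algebra.
From mathcomp Require Import ring lra.
From mathcomp Require Import all_classical all_reals all_analysis.

Import Order.TTheory GRing.Theory Num.Theory.
Import numFieldNormedType.Exports.

Local Open Scope classical_set_scope.
Local Open Scope ring_scope.

(** * Finite-dimensional normed spaces: continuous coordinates, dual, convergent subsequences *)

Lemma free_spanning_family (R : realType) (V : normedModType R) :
  finite_dimensional V -> exists (n : nat) (e : 'I_n -> V),
    (forall v, exists c : 'I_n -> R, v = \sum_(i < n) c i *: e i) /\
    (forall c : 'I_n -> R, \sum_(i < n) c i *: e i = 0 -> forall i, c i = 0).
Proof.
pose P n := `[< exists e : 'I_n -> V,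
  forall v, exists c : 'I_n -> R, v = \sum_(i < n) c i *: e i >].
move=> fdV; have exP : exists n, P n.
  by case: fdV => n he; exists n; apply/asboolP.
(* Take a spanning family of least length: a relation with [c i] nonzero would express [e i] through
   the other vectors and give a shorter one. *)
case: (ex_minnP exP) => n /asboolP[e espan] nmin.
exists n, e; split=> // c ce0 i.
apply: contrapT => /eqP ci0.
case: n => [|n] in e espan nmin c ce0 i ci0 *; first by case: i ci0.
suff /nmin : P n by rewrite ltnn.
apply/asboolP; exists (e \o lift i) => v; have [d vE] := espan v.
exists (fun j => d (lift i j) - d i / c i * c (lift i j)).
transitivity (\sum_i d i *: e i - (d i / c i) *: \sum_i c i *: e i).
  by rewrite ce0 scaler0 subr0.
rewrite scaler_sumr -sumrB.
rewrite (bigD1_ord i)//= scalerA divfK// subrr add0r.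
by apply: eq_bigr => j _; rewrite scalerA -scalerBl.
Qed.

(** Coordinates in a basis are bounded because the injective continuous map [g] from row vectors to
    [V] keeps its norm away from 0 on the compact unit sphere. *)
Lemma finite_dimensional_coord (R : realType) (V : normedModType R) :
  finite_dimensional V ->
  exists (n : nat) (e : 'I_n -> V) (eps : 'I_n -> dual V),
    forall v, v = \sum_(i < n) eps i v *: e i.
Proof.
move=> /free_spanning_family[n [e [/choice[c cE] efree]]].
exists n, e; pose g (r : 'rV[R]_n) := \sum_(i < n) r 0 i *: e i.
have cg r i : c (g r) i = r 0 i.
  apply/eqP; rewrite -subr_eq0; apply/eqP.
  apply: (efree (fun i => c (g r) i - r 0 i)).
  under eq_bigr do rewrite scalerBl.
  by rewrite sumrB -cE subrr.
have gc v : g (\row_i c v i) = v.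
  by rewrite [RHS]cE; apply: eq_bigr => i _; rewrite mxE.
have cont_g : continuous g.
  have cont_coord i : continuous (fun r : 'rV[R]_n => r 0 i *: e i).
    by move=> r; apply: (@cvgZr_tmp _ _ _ (nbhs r)); exact: coord_continuous.
  move=> r; apply: cvg_big => [||i _]; first exact: add_continuous.
    exact: nbhs_filter.
  exact: cont_coord.
have gZ a r : g (a *: r) = a *: g r.
  by rewrite scaler_sumr; apply: eq_bigr => i _; rewrite mxE scalerA.
have g0 r : g r = 0 -> r = 0.
  by move=> gr0; apply/rowP => i; rewrite mxE; exact: (efree (fun i => r 0 i)).
pose S := [set r : 'rV[R]_n | `|r| = 1].
have SP r : r != 0 -> S (`|r|^-1 *: r).
  by move=> r0; rewrite /S/= normrZ normfV normr_id mulVf// normr_eq0.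
have cptS : compact S.
  apply: bounded_closed_compact.
    by exists 1; split => // M M1 r /= ->; exact: ltW.
  rewrite (_ : S = (fun r => `|r|) @^-1` [set 1])//.
  apply: preimage_closed; first by move=> r _; exact: norm_continuous.
  exact: closed_eq.
have [M cM] : exists M, forall v i, `|c v i| <= M * `|v|.
  (* An empty sphere leaves only the zero row vector, so [M = 0] works; otherwise [M] is the inverse
     of the minimum of [|g|] on the sphere. *)
  have [S0|S0] := pselect (S !=set0); last first.
    exists 0 => v i; rewrite mul0r; have [r0|r0] := eqVneq (\row_i c v i) 0.
      by move/rowP : r0 => /(_ i); rewrite !mxE => ->; rewrite normr0.
    by exfalso; apply: S0; eexists; exact: SP r0.
  have [r0 r0S r0min] : exists2 r, r \in S & forall t, t \in S -> `|g r| <= `|g t|.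
    apply: compact_EVT_min => //; apply: continuous_subspaceT => r.
    by apply: continuous_comp; [exact: cont_g|exact: norm_continuous].
  have gr0 : 0 < `|g r0|.
    rewrite normr_gt0; apply/eqP => /g0 r00; move: r0S.
    by rewrite inE /S/= r00 normr0 => /eqP; rewrite eq_sym oner_eq0.
  exists (`|g r0|^-1) => v i; rewrite ler_pdivlMl//.
  have [r00|rn0] := eqVneq (\row_i c v i) 0.
    by move/rowP : r00 => /(_ i); rewrite !mxE => ->; rewrite normr0 mulr0.
  have := r0min _ (mem_set (SP _ rn0)).
  rewrite gZ gc normrZ normfV normr_id ler_pdivlMl ?normr_gt0//.
  apply: le_trans; rewrite mulrC ler_wpM2r//.
  pose F (ij : 'I_1 * 'I_n) := `|(\row_i c v i) ij.1 ij.2|.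
  rewrite [leRHS](_ : _ = \big[Num.max/0]_ij F ij); last first.
    by rewrite [LHS]/Num.norm/= mx_normrE.
  by have := le_bigmax 0 F (0, i); rewrite {1}/F mxE.
have lin i : linear (fun v => c v i : R^o).
  move=> a x y; pose r : 'rV[R]_n := a *: (\row_i c x i) + (\row_i c y i).
  have <- : g r = a *: x + y.
    rewrite /r -{2}(gc x) -{2}(gc y) scaler_sumr -big_split/=.
    by apply: eq_bigr => j _; rewrite !mxE scalerDl scalerA.
  by rewrite cg !mxE.
have epsP i : (fun v => c v i : R^o) \in dual_pred.
  rewrite inE; split => //.
  pose L := GRing.isLinear.Build R V R^o *:%R (fun v => c v i : R^o) (lin i).
  pose l : {linear V -> R^o} := HB.pack (fun v => c v i : R^o) L.
  apply/(@linear_bounded_continuous _ _ _ l); apply/bounded_funP => r.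
  exists (`|M| * r) => x xr; apply: le_trans (cM x i) _.
  apply: (@le_trans _ _ (`|M| * `|x|)); first by rewrite ler_wpM2r// ler_norm.
  by rewrite ler_wpM2l.
by exists (fun i => Dual (epsP i)) => v; rewrite -cE.
Qed.

(** The coordinate forms span the dual: [l] is the sum of the [l (e i) *: eps i]. *)
Lemma finite_dimensional_dual (R : realType) (V : normedModType R) :
  finite_dimensional V -> finite_dimensional (dual V).
Proof.
move=> /finite_dimensional_coord[n [e [eps vE]]]; exists n, eps => l.
exists (fun i => l (e i)); apply/val_inj/funext => v /=.
have -> (s : seq 'I_n) (F : 'I_n -> dual V) :
    \val (\sum_(i <- s) F i) v = \sum_(i <- s) F i v :> R.
  by elim/big_rec2 : _ => // i x y _ <-.
rewrite {1}(vE v) linear_sum; apply: eq_bigr => i _.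
by rewrite linearZ /= /GRing.scale/= mulrC.
Qed.

Lemma increasing_seq_cvgny (f : nat -> nat) : increasing_seq f -> f @ \oo --> \oo.
Proof.
move=> fi; apply/cvgnyPge => A; exists A => // n /= An.
have : (n <= f n)%N.
  by elim: n {An} => // n IH; rewrite (leq_ltn_trans IH)// (leqW_mono fi).
exact: leq_trans.
Qed.

Lemma bounded_cvg_subsequences (R : realType) (n : nat) (w : 'I_n -> nat -> R) :
  (forall i, bounded_fun (w i)) ->
  exists2 f : nat -> nat, f @ \oo --> \oo & forall i, cvgn (w i \o f).
Proof.
elim: n w => [|n IH] w bw; first by exists id => //; case.
have [f fy fcvg] := IH (fun i => w (lift ord0 i)) (fun i => bw _).
have [|g /increasing_seq_cvgny gy gcvg] := @bolzano_weierstrass _ (w ord0 \o f).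
  by have [M [Mr wM]] := bw ord0; exists M; split => // N /wM wN k _; exact: wN.
exists (f \o g); first exact: cvg_comp gy fy.
move=> i; have [->//|] := eqVneq i ord0.
case: (unliftP ord0 i) => [j ->|->]; last by rewrite eqxx.
move=> _; apply/cvg_ex; have /cvg_ex[l wl] := fcvg j; exists l.
exact: cvg_comp gy wl.
Qed.

(** Bolzano-Weierstrass in each coordinate, the coordinate forms being bounded on balls. *)
Lemma finite_dimensional_subsequence (R : realType) (V : normedModType R)
    (u : nat -> V) (M : R) :
  finite_dimensional V -> (forall k, `|u k| <= M) ->
  exists (f : nat -> nat) (l : V), f @ \oo --> \oo /\ u \o f @ \oo --> l.
Proof.
move=> /finite_dimensional_coord[n [e [eps vE]]] uM.
have [i|f fy fcvg] := @bounded_cvg_subsequences R n (fun i k => eps i (u k)).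
  have /bounded_funP/(_ M)[N epsN] : bounded_near (eps i) (nbhs (0 : V)).
    by apply/linear_bounded_continuous; exact: dual_continuous.
  exists N; split; first exact: num_real.
  by move=> N' /ltW NN' k _; apply: le_trans NN'; apply: epsN.
exists f, (\sum_i lim (eps i (u (f k)) @[k --> \oo]) *: e i); split => //.
rewrite (_ : u \o f = fun k => \sum_i eps i (u (f k)) *: e i); last first.
  by apply/funext => k /=; exact: vE.
apply: cvg_big => [|i _]; first exact: add_continuous.
by apply: cvgZr_tmp; exact: fcvg.
Qed.

(** * Hahn-Banach in finite dimension *)

(** One-dimensional extension step, with [E x r] read as membership in an epigraph. Points with
    [phi < 0] bound the slope [alpha] from below, those with [phi > 0] from above, and convexity
    makes the bounds compatible. *)
Lemma linear_minorant_extension (R : realType) (V : lmodType R) (S : set V)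
    (E : V -> R -> Prop) (l phi : {linear V -> R^o}) :
  (forall a b x y, S x -> S y -> S (a *: x + b *: y)) ->
  (forall t x y r s, 0 <= t <= 1 -> E x r -> E y s ->
    E (t *: x + (1 - t) *: y) (t * r + (1 - t) * s)) ->
  (forall x, exists r, E x r) ->
  (forall x r, S x -> phi x = 0 -> E x r -> l x <= r) ->
  exists alpha, forall x r, S x -> E x r -> l x + alpha * phi x <= r.
Proof.
move=> Slin Econv Eex Eker.
have SN x : S x -> S (- x).
  by move=> Sx; have := Slin (-1) 0 x x Sx Sx; rewrite scaleN1r scale0r addr0.
pose A := [set a | exists d r,
  [/\ S d, phi d < 0, E d r & a = (l d - r) / - phi d]].
have AB c r : S c -> 0 < phi c -> E c r -> ubound A ((r - l c) / phi c).
  move=> Sc c0 Ecr _ [d [s [Sd d0 Eds ->]]].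
  have cd0 : 0 < phi c - phi d by rewrite subr_gt0 (lt_trans d0).
  (* This weight puts [t *: c + (1 - t) *: d] in the kernel of [phi], where [l] is already a
     minorant. *)
  have [t [tE t1]] : exists t, t = - phi d / (phi c - phi d) /\
      1 - t = phi c / (phi c - phi d).
    by eexists; split; first reflexivity; field; rewrite gt_eqF.
  have t01 : 0 <= t <= 1.
    by rewrite -[t <= 1]subr_ge0 t1 tE !divr_ge0 ?oppr_ge0 ?ltW.
  have := Eker _ _ (Slin t (1 - t) _ _ Sc Sd) _ (Econv _ _ _ _ _ t01 Ecr Eds).
  rewrite !linearD !linearZ /= /GRing.scale/= t1 tE => H.
  have {}H : (- phi d / (phi c - phi d)) * l c + phi c / (phi c - phi d) * l d <=
     - phi d / (phi c - phi d) * r + phi c / (phi c - phi d) * s.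
    by apply: H; field; rewrite gt_eqF.
  rewrite ler_pdivrMr ?oppr_gt0// mulrAC ler_pdivlMr//.
  rewrite -subr_ge0.
  rewrite -subr_ge0 in H.
  have := mulr_ge0 H (ltW cd0); congr (_ <= _).
  by field; rewrite gt_eqF.
(* If [phi] is nowhere positive on [S], it vanishes there, since [S] is stable under opposites. *)
have [[c [Sc c0]]|noc] := pselect (exists c, S c /\ 0 < phi c); last first.
  exists 0 => x r Sx Exr; rewrite mul0r addr0; apply: Eker => //.
  apply/eqP; rewrite eq_le !leNgt; apply/andP; split; apply/negP => x0.
    by apply: noc; exists x.
  by apply: noc; exists (- x); rewrite linearN oppr_gt0; split => //; exact: SN.
(* The supremum is finite: [c] makes [A] bounded above and [- c] makes it nonempty. *)
exists (sup A) => x r Sx Exr.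
have [x0|x0|x0] := ltgtP (phi x) 0.
- have : (l x - r) / - phi x <= sup A.
    apply: ub_le_sup; last by exists x, r.
    by have [s Ecs] := Eex c; exists ((s - l c) / phi c); exact: AB.
  by rewrite ler_pdivrMr ?oppr_gt0// mulrN lerBlDr addrC lerBrDr.
- have : sup A <= (r - l x) / phi x.
    apply: ge_sup; last exact: AB.
    have [s Ecs] := Eex (- c); exists ((l (- c) - s) / - phi (- c)), (- c), s.
    by split=> //; [exact: SN|rewrite linearN oppr_lt0].
  by rewrite ler_pdivlMr// lerBrDl.
- by rewrite x0 mulr0 addr0; exact: Eker.
Qed.

(* A Hahn-Banach sandwich: [E] stands for the epigraph of an everywhere finite
   convex function that is nonnegative at [0]. *)
Lemma finite_dimensional_minorant (R : realType) (V : normedModType R)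
    (E : V -> R -> Prop) :
  finite_dimensional V ->
  (forall t x y r s, 0 <= t <= 1 -> E x r -> E y s ->
    E (t *: x + (1 - t) *: y) (t * r + (1 - t) * s)) ->
  (forall x, exists r, E x r) -> (forall r, E 0 r -> 0 <= r) ->
  exists l : dual V, forall x r, E x r -> l x <= r.
Proof.
move=> /finite_dimensional_coord[n [e [eps vE]]] Econv Eex E0.
(* Induct on the subspace where all coordinates of index at least [k] vanish: it is 0 for [k = 0]
   and the whole space for [k = n]. *)
suff /(_ n)[l lE] : forall k, exists l : dual V, forall x r,
    (forall i : 'I_n, (k <= i)%N -> eps i x = 0) -> E x r -> l x <= r.
  by exists l => x r; apply: lE => i; rewrite leqNgt ltn_ord.
elim=> [|k [l lE]].
  exists 0 => x r eps0; have -> : x = 0.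
    by rewrite (vE x) big1// => i _; rewrite eps0// scale0r.
  exact: E0.
have [kn|nk] := ltnP k n; last first.
  exists l => x r _; apply: lE => i ki.
  by have := leq_trans nk ki; rewrite leqNgt ltn_ord.
pose S : set V := [set x | forall i : 'I_n, (k.+1 <= i)%N -> eps i x = 0].
have [|x r Sx x0|alpha alphaE] :=
    @linear_minorant_extension R V S E l (eps (Ordinal kn)) _ Econv Eex.
- move=> a b x y Sx Sy i ki.
  by rewrite linearD !linearZ/= (Sx _ ki) (Sy _ ki) !scaler0 addr0.
- apply: lE => i; rewrite leq_eqVlt => /predU1P[ki|/Sx//].
  by rewrite -x0; congr (eps _ _); apply/val_inj.
- by exists (l + alpha *: eps (Ordinal kn)) => x r Sx /alphaE; apply.
Qed.

(** * Convex functions: global minimality, penalized minimizers and subgradients *)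

Section convex_analysis.
Context {R : realType} {V : normedModType R} (f : V -> \bar R).
Hypotheses (f_neqNy : forall x, f x != -oo%E) (f_convex : econvex f).

Lemma edom_fin_num x : edom f x -> f x \is a fin_num.
Proof. by move=> fx; rewrite fin_numE f_neqNy -ltey. Qed.

(** Points of the segment towards [u] close enough to [x] have value at least [f x]; convexity
    transfers this to [u] after division by [t]. *)
Lemma local_minimizer_global x : edom f x -> local_minimizer f x ->
  forall u, (f x <= f u)%E.
Proof.
move=> /edom_fin_num/fineK fxE fx_min u.
have [->|] := eqVneq (f u) +oo%E; first by rewrite leey.
rewrite -ltey => /edom_fin_num/fineK fuE.
have : (t *: u + (1 - t) *: x) @[t --> (0:R)^'+] --> x.
  rewrite -[X in _ --> X](_ : 0 *: u + (1 - 0) *: x = x); last first.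
    by rewrite scale0r add0r subr0 scale1r.
  apply: cvg_at_right_filter; apply: cvgD; apply: cvgZr_tmp; first exact: cvg_id.
  by apply: cvgB; [exact: cvg_cst|exact: cvg_id].
move=> /(_ _ fx_min) fx_min0.
have [t [/= fxt t0 t1]] : exists t : R,
    [/\ (f x <= f (t *: u + (1 - t) *: x)%R)%E, 0 < t & t < 1].
  apply: (@filter_ex _ (0:R)^'+); near=> t; split; near: t => //.
    exact: nbhs_right_gt.
  exact: nbhs_right_lt.
have t01 : 0 <= t <= 1 by rewrite !ltW.
have := le_trans fxt (f_convex u x t t01).
rewrite -fxE -fuE -!EFinM -EFinD !lee_fin => h.
rewrite -subr_ge0 -(pmulr_rge0 _ t0); lra.
Unshelve. all: by end_near. Qed.

(** Direct method: the penalty bounds a minimizing sequence, and lower semicontinuity passes to the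
    limit of a subsequence. *)
Lemma finite_dimensional_penalized_minimizer (z : V) (m sigma : R) :
  finite_dimensional V -> lower_semicontinuous f -> 0 < sigma ->
  (forall u, (m%:E <= f u)%E) -> edom f z ->
  exists2 y, edom f y &
    forall u, (f y + (sigma * `|y - z|)%:E <= f u + (sigma * `|u - z|)%:E)%E.
Proof.
move=> fdV f_lsc sigma0 fm /edom_fin_num/fineK fzE.
(* Real upper bounds [r] of [f u] stand for its values, so that the infimum is taken in the
   reals. *)
pose A := [set a | exists u r, (f u <= r%:E)%E /\ a = r + sigma * `|u - z|].
have Alb : lbound A m.
  move=> _ [u [r [fur ->]]]; rewrite -[m]addr0.
  apply: lerD; last by rewrite mulr_ge0// ltW.
  by rewrite -lee_fin (le_trans (fm u)).
have A0 : A !=set0 by eexists; exists z, (fine (f z)); split; rewrite ?fzE.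
have Ainf : has_inf A by split => //; exists m.
have /choice[w wP] : forall k : nat, exists ur : V * R,
    (f ur.1 <= ur.2%:E)%E /\ ur.2 + sigma * `|ur.1 - z| < inf A + k.+1%:R^-1.
  move=> k; have [|_ [u [r [fur ->]]] ?] := @inf_adherent _ A k.+1%:R^-1 _ Ainf.
    by rewrite invr_gt0.
  by exists (u, r).
(* The radius comes from [m + sigma * |u - z| <= inf A + 1] along the sequence. *)
have [k|g [y [gy uy]]] := @finite_dimensional_subsequence _ _ (fun k => (w k).1)
    (`|z| + (inf A + 1 - m) / sigma) fdV.
  rewrite -[(w k).1](subrK z) addrC (le_trans (ler_normD _ _))// lerD2l.
  rewrite ler_pdivlMr// mulrC lerBrDl.
  have [fw wlt] := wP k.
  have wm : m <= (w k).2 by rewrite -lee_fin; exact: le_trans (fm _) fw.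
  apply: (le_trans (lerD wm (lexx _))); apply: (le_trans (ltW wlt)).
  by rewrite lerD2l invf_le1// ler1n.
have fyA : (f y + (sigma * `|y - z|)%:E <= (inf A)%:E)%E.
  rewrite leNgt; apply/negP; rewrite -lteBlDr// -EFinB => lt_fy.
  (* If the value at [y] exceeded [inf A], then [f > b] near [y] would contradict the
     near-optimality of the sequence. *)
  have [b infb /f_lsc[U Uy Ub]] : exists2 b,
      inf A - sigma * `|y - z| < b & (b%:E < f y)%E.
    case: (f y) lt_fy (f_neqNy y) => // [c|_ _]; last first.
      by exists (inf A - sigma * `|y - z| + 1); [rewrite ltrDl|exact: ltry].
    by rewrite lte_fin => /midf_lt[lt1 lt2] _; eexists; [exact: lt1|rewrite lte_fin].
  have slim : inf A + (g k).+1%:R^-1 - sigma * `|(w (g k)).1 - z| @[k --> \oo] -->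
      inf A - sigma * `|y - z|.
    apply: cvgB.
      rewrite -[X in _ --> X]addr0; apply: cvgD; first exact: cvg_cst.
      exact: (cvg_comp _ _ gy cvg_harmonic).
    by apply: cvgZl_tmp; apply: cvg_norm; apply: cvgB => //; exact: cvg_cst.
  have [k [Uk]] : exists k, U (w (g k)).1 /\
      inf A + (g k).+1%:R^-1 - sigma * `|(w (g k)).1 - z| < b.
    apply: (@filter_ex _ \oo); near=> k; split; near: k; first exact: uy.
    exact: cvgr_lt slim _ infb.
  apply/negP; rewrite -leNgt lerBrDr; have [fw /ltW] := wP (g k); apply: le_trans.
  by rewrite lerD2r -lee_fin; apply: le_trans fw; exact: ltW (Ub _ Uk).
exists y.
  rewrite /edom/= ltNge leye_eq; apply/negP => /eqP fyy.
  by move: fyA; rewrite fyy.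
move=> u; apply: (le_trans fyA).
have [->|] := eqVneq (f u) +oo%E; first by rewrite leey.
rewrite -ltey => /edom_fin_num/fineK fuE.
rewrite -fuE -EFinD lee_fin; apply: ge_inf; first by exists m.
by exists u, (fine (f u)); rewrite fuE.
Unshelve. all: by end_near. Qed.


Lemma penalized_minimizer_subgradient (y : V) (sigma : R) :
  finite_dimensional V -> edom f y -> 0 <= sigma ->
  (forall u, (f y <= f u + (sigma * `|u - y|)%:E)%E) ->
  exists2 l : dual V, subdifferential f y l & `|l| <= sigma.
Proof.
move=> fdV fy sigma0 ymin; have /fineK fyE := edom_fin_num _ fy.
set c := fine (f y) in fyE.
(* [E] collects the upper bounds of the terms of the infimal convolution of [f (y + _) - f y] and
   [sigma * |_|]; a linear minorant of it lies below both functions. *)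
pose E x r := exists h a,
  (f (y + h)%R <= (c + a)%:E)%E /\ a + sigma * `|x - h| <= r.
have [|x|r|l lE] := @finite_dimensional_minorant _ _ E fdV.
- move=> t x1 x2 r1 r2 t01 [h1 [a1 [fh1 ar1]]] [h2 [a2 [fh2 ar2]]].
  exists (t *: h1 + (1 - t) *: h2), (t * a1 + (1 - t) * a2).
  have /andP[t0 t1] := t01; have {}t1 : 0 <= 1 - t by rewrite subr_ge0.
  split.
    rewrite (_ : y + _ = t *: (y + h1) + (1 - t) *: (y + h2)); last first.
      by rewrite !scalerDr addrACA -scalerDl [t + _]addrC subrK scale1r.
    apply: le_trans (f_convex _ _ _ t01) _.
    rewrite (_ : c + _ = t * (c + a1) + (1 - t) * (c + a2)); last by ring.
    by rewrite [leRHS]EFinD !EFinM leeD// lee_wpmul2l// lee_fin.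
  apply: le_trans (lerD (ler_wpM2l t0 ar1) (ler_wpM2l t1 ar2)).
  rewrite !mulrDr addrACA lerD2l !mulrA -!(mulrC sigma) -!mulrA -mulrDr ler_wpM2l//.
  rewrite opprD addrACA -!scalerBr
    (le_trans (ler_normD _ _))// !normrZ !ger0_norm//.
- by exists (sigma * `|x|), 0, 0; rewrite !addr0 fyE subr0 add0r.
- move=> [h [a [fh]]]; rewrite sub0r normrN; apply: le_trans.
  rewrite -(lerD2l c) addr0 addrA -lee_fin fyE; apply: le_trans (ymin (y + h)) _.
  rewrite (_ : y + h - y = h); last by rewrite addrC addKr.
  by rewrite [leRHS]EFinD leeD2r.
(* Taking [h = 0] gives the norm bound; [h = u - y] below gives the subgradient inequality. *)
have l_sigma x : l x <= sigma * `|x|.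
  by apply: lE; exists 0, 0; rewrite !addr0 fyE subr0 add0r.
exists l.
  split=> // u; have [->|] := eqVneq (f u) +oo%E; first by rewrite -fyE leey.
  rewrite -ltey => /edom_fin_num/fineK fuE; rewrite -fuE -fyE -EFinB lee_fin.
  apply: lE; exists (u - y), (fine (f u) - c).
  by rewrite subrr normr0 mulr0 addr0 addrC subrK addrC subrK fuE.
apply: dual_norm_le => x x1; rewrite ler_norml lerNl -linearN.
rewrite !(le_trans (l_sigma _))// ?normrN ler_piMr//.
Qed.

(** At a minimizer [y] of [f + sigma * |_ - z|], the triangle inequality recentres the penalty at
    [y], giving [l]; comparison with the value at [z] gives the distance. *)
Lemma approximate_minimizer_subgradient (x z : V) (sigma delta : R) :
  finite_dimensional V -> lower_semicontinuous f -> edom f x ->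
  (forall u, (f x <= f u)%E) -> 0 < sigma ->
  (f z < f x + (sigma * delta)%:E)%E ->
  exists y (l : dual V),
    [/\ subdifferential f y l, `|l| <= sigma & `|y - z| < delta].
Proof.
move=> fdV f_lsc /edom_fin_num/fineK fxE xmin sigma0 fz.
have fz_dom : edom f z by apply: lt_trans fz _; rewrite -fxE ltry.
have [|y fy ymin] := finite_dimensional_penalized_minimizer
  z (fine (f x)) sigma fdV f_lsc sigma0 _ fz_dom.
  by move=> u; rewrite fxE.
have [|u|l lf ls] := @penalized_minimizer_subgradient y sigma fdV fy.
- exact: ltW.
- have := ymin u; have /fineK <- := edom_fin_num _ fy.
  have [->|] := eqVneq (f u) +oo%E; first by move=> _; rewrite addye// leey.
  rewrite -ltey => /edom_fin_num/fineK <-; rewrite -!EFinD !lee_fin => h.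
  have : sigma * `|u - z| <= sigma * `|u - y| + sigma * `|y - z|.
    by rewrite -mulrDr ler_pM2l// ler_distD.
  lra.
exists y, l; split => //; rewrite -(ltr_pM2l sigma0) -lte_fin.
have := ymin z; rewrite subrr normr0 mulr0 addr0.
move=> /le_lt_trans/(_ fz); have := xmin y; rewrite -fxE.
by have /fineK <- := edom_fin_num _ fy; rewrite -!EFinD lee_fin !lte_fin; lra.
Qed.

End convex_analysis.

(** * The two implications between sharpness and positive definiteness *)

Section sharp_minimizer_and_graphical_derivative.
Context {R : realType} {X : normedModType R}.

Lemma dual_norm_apply (l : dual X) x : `|l x| <= `|l| * `|x|.
Proof.
have [->|x0] := eqVneq x 0; first by rewrite linear0 !normr0 mulr0.
rewrite -ler_pdivrMr ?normr_gt0//.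
have := @dual_norm_ub _ _ l (`|x|^-1 *: x).
rewrite linearZ !normrZ normfV normr_id mulVf ?normr_eq0// mulrC; exact.
Qed.

Lemma cvg_dual_apply (v : nat -> dual X) (u : nat -> X) (l : dual X) (x : X) :
  v @ \oo --> l -> u @ \oo --> x -> v k (u k) @[k --> \oo] --> (l x : R).
Proof.
move=> vl ux.
have -> : (fun k => v k (u k)) = (fun k => (v k - l) (u k) + l (u k)).
  by apply/funext => k; rewrite -[v k in LHS](subrK l).
rewrite -[X in _ --> X]add0r; apply: cvgD; last first.
  exact: (cvg_comp _ _ ux (@dual_continuous _ _ l x)).
apply/norm_cvg0P.
apply: (@squeeze_cvgr _ _ _ _ (fun=> 0) (fun k => `|v k - l| * `|u k|)).
- by near=> k; rewrite normr_ge0 dual_norm_apply.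
- exact: cvg_cst.
- rewrite -[X in _ --> X](mul0r `|x|); apply: cvgM; last exact: cvg_norm.
  rewrite -(normr0 (dual X)) -(subrr l); apply: cvg_norm.
  by apply: cvgB => //; exact: cvg_cst.
Unshelve. all: by end_near. Qed.

Context (q : R) (f : X -> \bar R) (xbar : X).
Hypotheses (q_gt0 : 0 < q) (f_neqNy : forall x, f x != -oo%E).
Let D := graphical_derivative q (subdifferential f) xbar 0.
Let c : R := q `^ q / (q + 1) `^ (q + 1).

Lemma gt0_continuous_powR (p a : R) : 0 < a -> {for a, continuous (@powR R ^~ p)}.
Proof.
move=> a0; apply: differentiable_continuous; apply/derivable1_diffP.
by apply: derivable_powR; rewrite in_itv/= a0.
Qed.

(** Both sides are homogeneous in [t]: the step [t *: u] and the scaling [t ^ q] of [l] combine to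
    [t ^ (q + 1)], which cancels. *)
Lemma subdifferential_scale_ge (t rho : R) (u : X) (l : dual X) :
  0 < t -> edom f xbar -> subdifferential f (xbar + t *: u) (t `^ q *: l) ->
  ((rho * `|xbar + t *: u - xbar| `^ (q + 1))%:E <= f (xbar + t *: u)%R - f xbar)%E ->
  rho * `|u| `^ (q + 1) <= l u.
Proof.
move=> t0 xbar_dom [xt_dom /(_ xbar)].
have /fineK <- := edom_fin_num _ f_neqNy _ xbar_dom.
have /fineK <- := edom_fin_num _ f_neqNy _ xt_dom.
rewrite -!EFinB !lee_fin opprD addNKr.
have tq : t `^ (q + 1) = t `^ q * t.
  by rewrite powRD ?powRr1 ?ltW// (gt_eqF t0) implybT.
have -> : (t `^ q *: l) (- (t *: u)) = - (t `^ (q + 1) * l u).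
  have -> : (t `^ q *: l) (- (t *: u)) = t `^ q * l (- (t *: u)) by [].
  by rewrite tq -mulrA linearN linearZ mulrN.
rewrite [xbar + _]addrC addrK normrZ gtr0_norm//.
rewrite (powRM _ (ltW t0) (normr_ge0 u)) mulrCA => lu sharp.
rewrite -(ler_pM2l (powR_gt0 (q + 1) t0)); lra.
Qed.

Lemma sharp_minimizer_posdef rho :
  sharp_minimizer_mod (q + 1) f xbar rho -> posdef_mod q D rho.
Proof.
move=> [rho0 xbar_dom xbar_sharp]; split => // -[x l] /=.
move=> [u [v [t [ux vl [t0 t_cvg0] uvt]]]].
have q1 : 0 < q + 1 by rewrite addr_gt0.
(* Both sides vanish at [x = 0]; elsewhere the power is continuous at [|x| > 0]. *)
have [->|x0] := eqVneq x 0.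
  by rewrite linear0 normr0 powR0 ?mulr0// gt_eqF.
have powu : rho * `|u k| `^ (q + 1) @[k --> \oo] --> rho * `|x| `^ (q + 1).
  apply: cvgZl_tmp; apply: (@cvg_comp _ _ _ (fun k => `|u k|)
    (@powR R ^~ (q + 1)) _ _ _ (cvg_norm ux)).
  by apply: gt0_continuous_powR; rewrite normr_gt0.
apply: (ler_cvg_to powu (cvg_dual_apply _ _ _ _ vl ux)).
have tu : xbar + t k *: u k @[k --> \oo] --> xbar.
  rewrite -[X in _ --> X]addr0 -(scale0r x); apply: cvgD; first exact: cvg_cst.
  exact: cvgZ.
near=> k; apply: (subdifferential_scale_ge (t k)) => //.
  by have := uvt k; rewrite /gph/= add0r.
by near: k; exact: (tu _ xbar_sharp).
Unshelve. all: by end_near. Qed.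

Hypotheses (f_lsc : lower_semicontinuous f) (f_convex : econvex f)
  (xbar_dom : edom f xbar) (xbar_min : local_minimizer f xbar).

(* [c] is the maximum of [a (1 - a) ^ q] over [a] in [[0, 1]], reached at
   [a = 1 / (q + 1)]: take [delta = a |z - xbar|] in the approximate subgradient. *)
Lemma nonsharp_point_subgradient (tau : R) (z : X) :
  finite_dimensional X -> 0 < tau ->
  (f z < f xbar + (c * tau * `|z - xbar| `^ (q + 1))%:E)%E ->
  exists y (l : dual X), [/\ subdifferential f y l, 0 < `|y - xbar|,
    `|y - xbar| <= 2 * `|z - xbar| & `|l| <= tau * `|y - xbar| `^ q].
Proof.
move=> fdX tau0 fz.
have fmin :=
  local_minimizer_global f f_neqNy f_convex _ xbar_dom xbar_min.
have q1 : 0 < q + 1 by rewrite addr_gt0.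
set r := `|z - xbar| in fz *.
have r0 : 0 < r.
  rewrite normr_gt0 subr_eq0; apply: contraTneq fz => zx.
  by rewrite /r zx subrr normr0 powR0 ?gt_eqF// mulr0 addr0 ltxx.
(* [s = r - r / (q + 1)] will bound [|y - xbar|] from below; [cE] splits the gap as [sigma * delta]
   with [sigma = tau * s ^ q] and [delta = r / (q + 1)]. *)
pose s := r * q / (q + 1).
have s0 : 0 < s by rewrite divr_gt0// mulr_gt0.
have rs : r = s + r / (q + 1) by rewrite /s; field; rewrite gt_eqF.
have powS (a : R) : 0 < a -> a `^ (q + 1) = a `^ q * a.
  by move=> a0; rewrite powRD ?powRr1 ?ltW// (gt_eqF a0) implybT.
have cE : c * tau * r `^ (q + 1) = tau * s `^ q * (r / (q + 1)).
  have sq : s `^ q * (q + 1) `^ q = r `^ q * q `^ q.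
    by rewrite -!powRM ?ltW// /s divfK// gt_eqF.
  have q1q : (q + 1) `^ q != 0 by rewrite gt_eqF// powR_gt0.
  rewrite /c !powS//;
  have -> : s `^ q = r `^ q * q `^ q / (q + 1) `^ q by rewrite -sq mulfK.
  by field; rewrite q1q gt_eqF.
rewrite cE in fz.
have [|y [l [lf ls yz]]] := approximate_minimizer_subgradient f f_neqNy
  f_convex _ _ _ _ fdX f_lsc xbar_dom fmin _ fz.
  by rewrite mulr_gt0// powR_gt0.
have sy : s <= `|y - xbar|.
  have := ler_distD y z xbar; rewrite -/r distrC {1}rs; lra.
exists y, l; split => //; first exact: lt_le_trans sy.
  have : r / (q + 1) <= r by rewrite ler_pdivrMr// ler_pMr// lerDr ltW.
  have := ler_distD z y xbar; rewrite -/r; lra.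
apply: (le_trans ls); rewrite ler_pM2l//.
by apply: ge0_ler_powR => //; rewrite ?nnegrE ?ltW// (lt_le_trans s0).
Qed.

Lemma posdef_sharp_minimizer (lambda tau : R) :
  finite_dimensional X -> posdef_mod q D lambda -> 0 < tau < lambda ->
  sharp_minimizer_mod (q + 1) f xbar (c * tau).
Proof.
move=> fdX [_ Dlambda] /andP[tau0 tau_lt].
have q1 : 0 < q + 1 by rewrite addr_gt0.
have c0 : 0 < c by rewrite divr_gt0// powR_gt0.
split => //; first by rewrite mulr_gt0.
apply: contrapT => nsharp.
have /choice[yl ylP] : forall k : nat, exists yl : X * dual X,
    [/\ subdifferential f yl.1 yl.2, 0 < `|yl.1 - xbar|,
      `|yl.1 - xbar| <= 2 * k.+1%:R^-1 &
      `|yl.2| <= tau * `|yl.1 - xbar| `^ q].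
  move=> k; have [z [zk fz]] : exists z, `|z - xbar| < k.+1%:R^-1 /\
      (f z < f xbar + (c * tau * `|z - xbar| `^ (q + 1))%:E)%E.
    apply: contrapT => noz; apply: nsharp; near=> z.
    rewrite leNgt; apply/negP => fz; apply: noz; exists z; split.
      near: z; apply: (cvgr_distC_lt id xbar (@cvg_id _ (nbhs xbar))).
      by rewrite invr_gt0.
    have /fineK xE := edom_fin_num _ f_neqNy _ xbar_dom.
    by move: fz; rewrite -xE lteBlDr// addeC.
  have [y [l [lf y0 yz ls]]] := nonsharp_point_subgradient tau z fdX tau0 fz.
  by exists (y, l); split => //=; apply: (le_trans yz); rewrite ler_pM2l// ltW.
(* Normalizing by the distance [t k] makes [u k] a unit vector and [|v k| <= tau], so both sequences
   have convergent subsequences. *)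
pose t k := `|(yl k).1 - xbar|.
have t0 k : 0 < t k by have [] := ylP k.
pose u k := (t k)^-1 *: ((yl k).1 - xbar).
pose v k := (t k `^ q)^-1 *: (yl k).2.
have u1 k : `|u k| = 1.
  by rewrite normrZ normfV normr_id mulVf// gt_eqF// (t0 k).
have vtau k : `|v k| <= tau.
  have [_ _ _ ls] := ylP k.
  rewrite normrZ normfV (ger0_norm (powR_ge0 _ _)) ler_pdivrMl ?powR_gt0//.
  by rewrite mulrC.
have t_cvg0 : t @ \oo --> 0.
  apply: (@squeeze_cvgr _ _ _ _ (fun=> 0) (fun k => 2 * k.+1%:R^-1)).
  - by near=> k; have [_ + + _] := ylP k => /ltW -> ->.
  - exact: cvg_cst.
  - by rewrite -(mulr0 2); apply: cvgZl_tmp; exact: cvg_harmonic.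
have [k|g [x [gy ux]]] := finite_dimensional_subsequence _ _ u 1 fdX.
  by rewrite u1.
have [k|h [l [hy vl]]] := finite_dimensional_subsequence _ _ (v \o g) tau
  (finite_dimensional_dual _ _ fdX).
  exact: vtau.
have {}ux : u \o (g \o h) @ \oo --> x := cvg_comp _ _ hy ux.
have x1 : `|x| = 1.
  apply: (cvg_unique _ (cvg_norm ux)) => //.
  by apply: cvg_near_cst; near=> k; rewrite /= u1.
have ltau : `|l| <= tau.
  by apply: (ler_cvg_to (cvg_norm vl) (cvg_cst tau)); near=> k; exact: vtau.
have /Dlambda /= : gph D (x, l).
  exists (u \o (g \o h)), (v \o (g \o h)), (t \o (g \o h)); split => //.
    split => [k|]; first exact: t0.
    exact: (cvg_comp _ _ (cvg_comp _ _ hy gy) t_cvg0).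
  move=> k; rewrite /gph/= add0r /u /v !scalerA !mulfV ?gt_eqF ?powR_gt0 ?(t0 _)//.
  by rewrite !scale1r addrC subrK; have [] := ylP (g (h k)).
(* Positive definiteness would give [lambda <= l x], yet [l x <= |l| * |x| <= tau]. *)
apply/negP; rewrite -ltNge x1 powR1 mulr1; apply: le_lt_trans tau_lt.
apply: le_trans (ler_norm _) _; apply: le_trans (dual_norm_apply _ _) _.
by rewrite x1 mulr1.
Unshelve. all: by end_near. Qed.

End sharp_minimizer_and_graphical_derivative.

(** * Equivalence and comparison of the best moduli *)

Theorem theorem3p16 (R : realType) (X : completeNormedModType R) (q : R)
    (f : X -> \bar R) (xbar : X)
    (q_gt0 : 0 < q)
    (f_neqNy : forall x, f x != -oo%E)
    (f_lsc : lower_semicontinuous f)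
    (f_convex : econvex f)
    (xbar_dom : edom f xbar)
    (xbar_min : local_minimizer f xbar) :
  let D : X -> set (dual X) :=
    graphical_derivative q (subdifferential f) xbar 0 in
  let c : R := q `^ q / (q + 1) `^ (q + 1) in
  [/\ forall rho : R,
        sharp_minimizer_mod (q + 1) f xbar rho -> posdef_mod q D rho,
      finite_dimensional X ->
        forall lambda tau : R, posdef_mod q D lambda ->
          0 < tau < lambda -> sharp_minimizer_mod (q + 1) f xbar (c * tau),
      finite_dimensional X ->
        (sharp_minimizer (q + 1) f xbar <-> posdef q D) &
      finite_dimensional X ->
        (c%:E * posdef_norm q D <= shrp (q + 1) f xbar)%E /\
        (shrp (q + 1) f xbar <= posdef_norm q D)%E].
Proof.
move=> D c.
have sharp_posdef rho :
    sharp_minimizer_mod (q + 1) f xbar rho -> posdef_mod q D rho.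
  exact: sharp_minimizer_posdef.
have posdef_sharp lambda tau : finite_dimensional X -> posdef_mod q D lambda ->
    0 < tau < lambda -> sharp_minimizer_mod (q + 1) f xbar (c * tau).
  exact: posdef_sharp_minimizer.
have c0 : 0 < c by rewrite divr_gt0// powR_gt0// addr_gt0.
split => // fdX; first by move=> lambda tau; exact: posdef_sharp.
- split=> [[rho /sharp_posdef Drho]|[lambda Dlambda]]; first by exists rho.
  (* Any [tau] strictly between 0 and [lambda] would do; the half is taken. *)
  have [lambda0 _] := Dlambda; exists (c * (lambda / 2)).
  apply: (posdef_sharp lambda) => //.
  by rewrite divr_gt0//= ltr_pdivrMr// ltr_pMr// ltr1n.
split; last first.
  apply: ub_ereal_sup => _ [->|[rho /sharp_posdef Drho <-]].
    by apply: ereal_sup_ubound; left.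
  by apply: ereal_sup_ubound; right; exists rho.
rewrite -lee_pdivlMl//; apply: ub_ereal_sup => _ [->|[lambda Dlambda <-]].
  apply: mule_ge0; first by rewrite lee_fin invr_ge0 ltW.
  by apply: ereal_sup_ubound; left.
have [lambda0 _] := Dlambda.
rewrite lee_pdivlMl// -EFinM leNgt; apply/negP.
have : (0 <= shrp (q + 1) f xbar)%E by apply: ereal_sup_ubound; left.
case shrpE : (shrp (q + 1) f xbar) => [s| |]//; rewrite lee_fin lte_fin => s0.
(* If the supremum [s] were below [c * lambda], the midpoint [a] would be a sharpness modulus above
   [s], obtained with [tau = a / c < lambda]. *)
move=> /midf_lt; set a := _ / _ => -[sa al].
have : (a%:E <= s%:E)%E.
  rewrite -shrpE; apply: ereal_sup_ubound; right; exists (c * (a / c)).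
    apply: (posdef_sharp lambda) => //.
    by rewrite divr_gt0//= ?(le_lt_trans s0)// ltr_pdivrMr// mulrC.
  by rewrite mulrC divfK// gt_eqF.
by rewrite lee_fin leNgt sa.
Qed.
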